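(* Consider the one-hidden-layer ReLU model, the data model, the GD and SAM iterates, and assumptions (A1) and (A2) described in the context. Suppose $w_0=U_1U_1^Tw_0$ and $0\prec I-\eta D_1-\eta\rho D_1^2\prec I$. Suppose there exists a numerical constant $c_0>1$ such that $$1-\eta d_r\le c_0(1-\eta d_1-\eta\rho d_1^2),\qquad 1-\eta d_1\ge\sqrt{c_0}\,(1-\eta d_r-\eta\rho d_r^2).$$ Let $\mathrm{SNR}=\|A(\bar w-w_0)\|_2^2/(r\sigma^2)$ and assume $\mathrm{SNR}\ge1$. If $$k\le\min\left\{\frac{\log[2/(\mathrm{SNR}+1)]}{\log[(1-\eta d_1-\eta\rho d_1^2)^2/(1-\eta d_r-\eta\rho d_r^2)]},\ \bar k\right\},$$ then $\mathrm{Error}(w_k^{\mathrm{SAM}})\le\mathrm{Error}(w_k^{\mathrm{GD}})$.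
   Context: Data and noise: $n$ data points $(y_i,x_i)$, $x_i\in\mathbb{R}^d$, are given, with $y_i=y_i^*+\epsilon_i$, where $y_i^*$ is the true noiseless observation and the $\epsilon_i$ are independent zero-mean noise values with $\mathbb{E}[\epsilon\epsilon^T]=\sigma^2I$, $\epsilon=(\epsilon_1,\dots,\epsilon_n)$. Model: $\Phi(w;x)=\sum_{l=1}^L\max(0,x^Tw^{(l)})$ with $w=(w^{(1)},\dots,w^{(L)})\in\mathbb{R}^p$, $w^{(l)}\in\mathbb{R}^d$, $p=dL$. Define $a(w;x)=(a_1(w;x),\dots,a_L(w;x))\in\mathbb{R}^p$ with $a_l(w;x)=x$ if $x^Tw^{(l)}>0$ and $a_l(w;x)=0$ if $x^Tw^{(l)}\le0$; then $\Phi(w;x)=a(w;x)^Tw$. The loss is $f(w)=\frac12\sum_{i=1}^n(y_i-\Phi(w;x_i))^2$. Algorithms: with step size $\eta>0$, $\rho\ge0$ and a common initial point $w_0\in\mathbb{R}^p$: $w_{k+1}^{\mathrm{SAM}}=w_k^{\mathrm{SAM}}-\eta\nabla f(w_k^{\mathrm{SAM}}+\rho\nabla f(w_k^{\mathrm{SAM}}))$; GD is the same with $\rho=0$, i.e. $w_{k+1}^{\mathrm{GD}}=w_k^{\mathrm{GD}}-\eta\nabla f(w_k^{\mathrm{GD}})$. Assumptions. (A1) There exists $\bar k\ge1$ such that $a(w_k^{\mathrm{SAM}};x_i)=a(w_k^{\mathrm{GD}};x_i)=a(w_0;x_i)$ for all $0\le k\le\bar k$ and $i\in[n]$. (A2)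 There exists $\bar w\in\mathbb{R}^p$ such that $a(\bar w;x_i)=a(w_0;x_i)$ and $y_i^*=a(\bar w;x_i)^T\bar w$ for all $i\in[n]$. Notation: $A\in\mathbb{R}^{n\times p}$ has $i$-th row $a(w_0;x_i)^T$, rank $r$, and singular value decomposition $A=V\Sigma U^T$ with $V=[V_1\ V_2]$, $U=[U_1\ U_2]$, $\Sigma=\begin{bmatrix}\Sigma_1&0\\0&0\end{bmatrix}$, where the diagonal matrix $\Sigma_1\in\mathbb{R}^{r\times r}$ collects the nonzero singular values (so $A=V_1\Sigma_1U_1^T$). Put $D_1=\Sigma_1^2=\mathrm{diag}(d_1,\dots,d_r)$, $d_1\ge\dots\ge d_r>0$. $\prec$ is the Loewner order. For a (noise-dependent) $w$: $\mathrm{Error}(w)=\mathbb{E}_\epsilon\left[\frac1n\sum_{i=1}^n(y_i^*-\Phi(w;x_i))^2\right]$.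
   Formalization: The formal theorem also assumes that, almost surely, the points w_k^SAM + ρ∇f(w_k^SAM) for k < k̄ have the same activation pattern as w_0; without this the claim fails (e.g. n=d=L=1, x=w_0=1, y*=10, ε=±0.1, η=0.1, ρ=1, k=1). *)

(* Defs.v *)
From HB Require Import structures.
From mathcomp Require Import all_boot all_order all_algebra.
From mathcomp Require Import all_classical all_reals all_analysis.

Set Implicit Arguments.
Unset Strict Implicit.
Unset Printing Implicit Defensive.

Import Order.TTheory GRing.Theory Num.Theory.
Import numFieldNormedType.Exports.

Local Open Scope classical_set_scope.
Local Open Scope ring_scope.

Section LinearAlgebra.
Context {R : realType}.

Definition dot m (u v : 'cV[R]_m) : R := (u^T *m v) 0 0.

(* The library norm `|u| on matrices is the sup norm, not the Euclidean one. *)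
Definition sqnorm2 m (u : 'cV[R]_m) : R := dot u u.

Definition posdef m (M : 'M[R]_m) : Prop :=
  M^T = M /\ forall u : 'cV[R]_m, u != 0 -> 0 < dot u (M *m u).

Definition loewner_lt m (M N : 'M[R]_m) : Prop := posdef (N - M).

(* Both equations are needed because m and q are not syntactically equal. *)
Definition orthogonal_mx m q (Q : 'M[R]_(m, q)) : Prop :=
  Q^T *m Q = 1%:M /\ Q *m Q^T = 1%:M.

(* A = V Sigma U^T with V = [V1 V2], U = [U1 U2]; the row vector s lists the
   r nonzero singular values in nonincreasing order. *)
Definition is_svd m q r (A : 'M[R]_(m, q))
    (V1 : 'M[R]_(m, r)) (V2 : 'M[R]_(m, m - r)) (s : 'rV[R]_r)
    (U1 : 'M[R]_(q, r)) (U2 : 'M[R]_(q, q - r)) : Prop :=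
  [/\ orthogonal_mx (row_mx V1 V2),
      orthogonal_mx (row_mx U1 U2),
      (forall i, 0 < s 0 i),
      (forall i j : 'I_r, (i <= j)%N -> s 0 j <= s 0 i) &
      A = row_mx V1 V2 *m
          (block_mx (diag_mx s) 0 0 0 : 'M[R]_(r + (m - r), r + (q - r))) *m
          (row_mx U1 U2)^T].

End LinearAlgebra.

Section Model.
Context {R : realType} {n d L : nat}.

(* Parameters are stacked in R^p, p = L * d: the l-th block of length d of w
   is w^(l), since mxvec concatenates the rows of an L x d matrix. *)
Definition block (w : 'cV[R]_(L * d)) (l : 'I_L) : 'cV[R]_d :=
  (row l (vec_mx w^T))^T.

Definition relu_net (w : 'cV[R]_(L * d)) (x : 'cV[R]_d) : R :=
  \sum_(l < L) Num.max 0 (dot x (block w l)).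

Definition act (w : 'cV[R]_(L * d)) (x : 'cV[R]_d) : 'cV[R]_(L * d) :=
  (mxvec (\matrix_(l < L, j < d)
            (if 0 < dot x (block w l) then x j 0 else 0)))^T.

Definition act_mx (w : 'cV[R]_(L * d)) (x : 'I_n -> 'cV[R]_d) :
    'M[R]_(n, L * d) :=
  \matrix_(i < n, j < L * d) act w (x i) j 0.

Definition loss (x : 'I_n -> 'cV[R]_d) (y : 'I_n -> R)
    (w : 'cV[R]_(L * d)) : R :=
  2^-1 * \sum_(i < n) (y i - relu_net w (x i)) ^+ 2.

(* The gradient of the loss. When some x_i^T w^(l) vanishes the ReLU is at its
   kink; there the derivative of the network in w is taken to be act w (x_i),
   i.e. the ReLU has derivative 0 at 0, and the chain rule gives the second
   branch. *)
Definition grad_loss (x : 'I_n -> 'cV[R]_d) (y : 'I_n -> R)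
    (w : 'cV[R]_(L * d)) : 'cV[R]_(L * d) :=
  if [forall i, forall l, dot (x i) (block w l) != 0]
  then \col_(j < L * d) 'D_(delta_mx j 0) (loss x y) w
  else \sum_(i < n) (relu_net w (x i) - y i) *: act w (x i).

Definition sam_ascent (x : 'I_n -> 'cV[R]_d) (y : 'I_n -> R) (rho : R)
    (w : 'cV[R]_(L * d)) : 'cV[R]_(L * d) :=
  w + rho *: grad_loss x y w.

Definition sam (x : 'I_n -> 'cV[R]_d) (y : 'I_n -> R) (eta rho : R)
    (w0 : 'cV[R]_(L * d)) (k : nat) : 'cV[R]_(L * d) :=
  iter k (fun w => w - eta *: grad_loss x y (sam_ascent x y rho w)) w0.

Definition gd (x : 'I_n -> 'cV[R]_d) (y : 'I_n -> R) (eta : R)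
    (w0 : 'cV[R]_(L * d)) (k : nat) : 'cV[R]_(L * d) :=
  iter k (fun w => w - eta *: grad_loss x y w) w0.

End Model.

Section Noise.
Context {R : realType} {disp : measure_display} {Omega : measurableType disp}.
Context {n : nat}.

Definition mutually_independent (P : probability Omega R)
    (eps : 'I_n -> {RV P >-> R}) : Prop :=
  forall (J : {set 'I_n}) (B : 'I_n -> set R),
    (forall i, measurable (B i)) ->
    P (\bigcap_(i in [set` J]) (eps i @^-1` B i)) =
    (\prod_(i in J) P (eps i @^-1` B i))%E.

Definition observed (P : probability Omega R) (ystar : 'I_n -> R)
    (eps : 'I_n -> {RV P >-> R}) (omega : Omega) : 'I_n -> R :=
  fun i => ystar i + eps i omega.

Definition pred_error {d L : nat} (P : probability Omega R)
    (x : 'I_n -> 'cV[R]_d) (ystar : 'I_n -> R)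
    (W : Omega -> 'cV[R]_(L * d)) : \bar R :=
  ('E_P[fun omega =>
         (n%:R^-1 * \sum_(i < n) (ystar i - relu_net (W omega) (x i)) ^+ 2)%R])%E.

End Noise.

(* Main.v *)
(* On a fixed activation pattern the loss is the least-squares loss of A. In the
   coordinates q(w) = Sigma_1 U_1^T (w - wbar), each GD or SAM step acts
   diagonally, q_j being contracted towards the noise coordinate (V_1^T eps)_j at
   rate g_j = 1 - eta d_j for GD and h_j = 1 - eta d_j - eta rho d_j^2 for SAM.
   Hence n * Error after k steps is sum_j (t_j^2k q_j(w_0)^2 + sigma^2 (1 - t_j^k)^2)
   with t = g or t = h. Writing G = g^k, H = h^k and C = c_0^k, the difference
   GD - SAM is
     sum_j ((G_j^2 - H_j^2) (q_j^2 + sigma^2) - 2 sigma^2 (G_j - H_j)).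
   The c_0 hypotheses give G_j <= C H_min and C H_max^2 <= G_j^2, so it is at least
     r sigma^2 (C - 1) ((SNR + 1) H_min^2 - 2 H_min),
   and the bound on k says exactly that 2 H_max <= (SNR + 1) H_min^2. *)
Require Import Defs.
From HB Require Import structures.
From mathcomp Require Import all_boot all_order all_algebra.
From mathcomp Require Import all_classical all_reals all_analysis.
From mathcomp Require Import measurable_realfun ring lra.

Set Implicit Arguments.
Unset Strict Implicit.
Unset Printing Implicit Defensive.

Import Order.TTheory GRing.Theory Num.Theory.
Import numFieldNormedType.Exports.

Local Open Scope classical_set_scope.
Local Open Scope ring_scope.

(** * Bilinearity of the dot product *)

Section DotProduct.
Context {R : realType} {m : nat}.
Implicit Types u v w : 'cV[R]_m.

Lemma dotE u v : dot u v = \sum_i u i 0 * v i 0.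
Proof. by rewrite /dot mxE; apply: eq_bigr => i _; rewrite mxE. Qed.

Lemma dotDr u v w : dot u (v + w) = dot u v + dot u w.
Proof. by rewrite /dot mulmxDr mxE. Qed.

Lemma dotZr a u v : dot u (a *: v) = a * dot u v.
Proof. by rewrite /dot -scalemxAr mxE. Qed.

End DotProduct.

(** * The ReLU network near a point and the gradient of its loss *)

Section Network.
Context {R : realType} {n d L : nat}.
Implicit Types (w v : 'cV[R]_(L * d)) (z : 'cV[R]_d).

Lemma blockD w v l : block (w + v) l = block w l + block v l.
Proof. by rewrite /block !linearD. Qed.

Lemma blockZ a w l : block (a *: w) l = a *: block w l.
Proof. by rewrite /block !linearZ. Qed.

Lemma dot_act w v z :
  dot (act w z) v =
    \sum_(l < L) if 0 < dot z (block w l) then dot z (block v l) else 0.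
Proof.
rewrite dotE (reindex _ (curry_mxvec_bij L d)) /=.
pose F l j := act w z (mxvec_index l j) 0 * v (mxvec_index l j) 0.
rewrite (eq_bigr (fun p => F p.1 p.2)) => [|[]//]; rewrite -pair_bigA /F /=.
apply: eq_bigr => l _.
rewrite (eq_bigr (fun j =>
  if 0 < dot z (block w l) then z j 0 * block v l j 0 else 0)).
  by case: ifP => _; [rewrite dotE | rewrite big1].
move=> j _; rewrite /act mxE mxvecE mxE /block !mxE.
by case: ifP => _; rewrite ?mul0r.
Qed.

Lemma relu_net_act w z : relu_net w z = dot (act w z) w.
Proof.
rewrite dot_act; apply: eq_bigr => l _.
by case: ltP => // h; rewrite max_l.
Qed.

(** Off the kinks, the sign of each preactivation is stable under small shifts, so the network is
    exactly affine along every line near [w]. *)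
Lemma relu_net_near w v z :
  (forall l, dot z (block w l) != 0) ->
  \forall h \near (0 : R)^',
    relu_net (h *: v + w) z = relu_net w z + h * dot (act w z) v.
Proof.
move=> w_nz.
have sgn_near l : \forall h \near (0 : R)^',
    (0 < dot z (block (h *: v + w) l)) = (0 < dot z (block w l)).
  set b := dot z (block w l); set c := dot z (block v l).
  have cvgl : h * c + b @[h --> (0 : R)^'] --> b.
    rewrite -[X in _ --> X]add0r -{2}[0](mul0r c).
    by apply: cvgD; [apply: cvgMl; exact: nbhs_dnbhs | exact: cvg_cst].
  have [b_gt0|b_le0] := ltP 0 b.
    near=> h; rewrite blockD blockZ dotDr dotZr.
    by near: h; exact: cvgr_gt b_gt0.
  (* Strictness matters: a zero preactivation could become positive after an arbitrarily small
     shift. *)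
  have b_lt0 : b < 0 by rewrite lt_neqAle w_nz.
  near=> h; rewrite blockD blockZ dotDr dotZr; apply/negbTE; rewrite -leNgt.
  by near: h; exact: cvgr_le b_lt0.
have sgn_near_all : \forall h \near (0 : R)^', forall l,
    (0 < dot z (block (h *: v + w) l)) = (0 < dot z (block w l)).
  exact: filter_forall.
near=> h.
have sgn_h := near sgn_near_all h _.
rewrite !relu_net_act (_ : act (h *: v + w) z = act w z).
  by rewrite dotDr dotZr addrC.
by rewrite /act; congr (mxvec _)^T; apply/matrixP => l j; rewrite !mxE sgn_h.
Unshelve. all: by end_near. Qed.

(** Off the kinks the true partial derivatives agree with the chain-rule formula, so one expression
    serves at every point. *)
Lemma grad_lossE (x : 'I_n -> 'cV[R]_d) (y : 'I_n -> R) w :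
  grad_loss x y w = \sum_(i < n) (relu_net w (x i) - y i) *: act w (x i).
Proof.
rewrite /grad_loss; case: ifP => // /forallP nz.
apply/matrixP => j o; rewrite ord1 mxE summxE {o}.
set v : 'cV[R]_(L * d) := delta_mx j 0.
have dot_v i : dot (act w (x i)) v = act w (x i) j 0.
  rewrite dotE (bigD1 j) //= [v j 0]mxE !eqxx mulr1 big1 ?addr0 // => k kj.
  by rewrite [v k 0]mxE (negbTE kj) mulr0.
under [RHS]eq_bigr do rewrite mxE.
apply: cvg_lim => //.
set S1 := (X in _ --> X).
(* For small [h] the loss is exactly quadratic along coordinate [j]; its difference quotient is
   [S1 + h * S2], with limit [S1]. *)
pose S2 : R := 2^-1 * \sum_i act w (x i) j 0 ^+ 2.
have quot_near : \forall h \near (0 : R)^',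
    S1 + h * S2 = h^-1 *: ((loss x y \o shift w) (h *: v) - loss x y w).
  have line_near : \forall h \near (0 : R)^', forall i,
      relu_net (h *: v + w) (x i) =
        relu_net w (x i) + h * dot (act w (x i)) v.
    by apply: filter_forall => i; apply: relu_net_near => l; exact: (forallP (nz i)).
  near=> h.
  have h_neq0 : h != 0 by near: h; exact: nbhs_dnbhs_neq.
  have lineh := near line_near h _.
  rewrite /= /loss -mulrBr -sumrB.
  rewrite (eq_bigr (fun i => 2 * h * ((relu_net w (x i) - y i) * act w (x i) j 0)
      + h ^+ 2 * act w (x i) j 0 ^+ 2)); last first.
    by move=> i _; rewrite lineh // dot_v; ring.
  rewrite big_split /= -!mulr_sumr -/S1 /S2 /GRing.scale /=.
  by field.
have cvgS1 : S1 + h * S2 @[h --> (0 : R)^'] --> S1.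
  rewrite -[X in _ --> X]addr0 -[X in _ + X](mul0r S2).
  by apply: cvgD; [exact: cvg_cst | apply: cvgMl; exact: nbhs_dnbhs].
exact: cvg_trans (near_eq_cvg quot_near) cvgS1.
Unshelve. all: by end_near. Qed.

End Network.

(** * Comparison of integrals almost everywhere *)

Section AlmostEverywhere.
Local Open Scope ereal_scope.
Import HBNNSimple.

(* The integral of a nonnegative function is a supremum over the simple
   functions below it, so neither [f] nor [g] has to be measurable. *)
Lemma ge0_le_integral_ae {R : realType} {disp : measure_display}
    {T : measurableType disp} (mu : {measure set T -> \bar R})
    (f g : T -> \bar R) :
  (forall t, 0 <= f t) -> (forall t, 0 <= g t) ->
  {ae mu, forall t, f t <= g t} -> \int[mu]_t f t <= \int[mu]_t g t.
Proof.
move=> f_ge0 g_ge0 [N [mN muN0 subN]].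
rewrite [leLHS]ge0_integralTE // [leRHS]ge0_integralTE //.
apply: ge_ereal_sup => _ [h h_le_f <-].
(* Setting [h] to 0 on the null set [N] puts it below [g] everywhere and keeps its integral. *)
apply: ereal_sup_ubound; exists (proj_nnsfun h (measurableC mN)) => /=.
  move=> t; rewrite mindicE; case: (boolP (t \in ~` N)) => [tN|_].
    rewrite mulr1; apply: le_trans (h_le_f t) _.
    apply: contrapT => fg; move: tN; rewrite inE; apply; exact: subN.
  by rewrite mulr0.
rewrite -!integralT_nnsfun; apply: ge0_ae_eq_integral => //.
- exact/measurable_EFinP.
- exact/measurable_EFinP.
- by move=> t _; rewrite lee_fin.
- by move=> t _; rewrite lee_fin.
exists N; split => // t /=; rewrite mindicE.
case: (boolP (t \in ~` N)) => [_|]; first by rewrite mulr1; case.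
by rewrite notin_setE /= => /contrapT.
Qed.

End AlmostEverywhere.

(** * First and second moments of the noise *)

Section Moments.
Context {R : realType} {disp : measure_display} {Omega : measurableType disp}.
Variable P : probability Omega R.
Implicit Types (X Y : Omega -> R) (a b : R).

(** Integrability travels with the value because additivity of the expectation requires it. *)
Definition has_mean X a := X \in Lfun P 1 /\ ('E_P[X] = a%:E)%E.

Lemma has_mean_cst a : has_mean (fun=> a) a.
Proof. by split; [exact: Lfun_cst | exact: expectation_cst]. Qed.

Lemma has_meanD X Y a b :
  has_mean X a -> has_mean Y b -> has_mean (fun t => X t + Y t) (a + b).
Proof.
move=> [LX EX] [LY EY]; split; first exact: (rpredD LX LY).
by rewrite EFinD -EX -EY; exact: expectationD.
Qed.

Lemma has_meanZ X a b : has_mean X a -> has_mean (fun t => b * X t) (b * a).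
Proof.
move=> [LX EX]; rewrite (_ : (fun t => b * X t) = b \o* X); last first.
  by apply/funext => t /=; rewrite mulrC.
split; first by apply: Lfun_scale.
by rewrite EFinM -EX; exact: expectationZl.
Qed.

Lemma has_mean_sum (I : Type) (r : seq I) (X : I -> Omega -> R) (a : I -> R) :
  (forall i, has_mean (X i) (a i)) ->
  has_mean (fun t => \sum_(i <- r) X i t) (\sum_(i <- r) a i).
Proof.
move=> Xa; elim: r => [|i r IHr].
  by rewrite big_nil (_ : (fun t => _) = fun=> 0);
    [exact: has_mean_cst | apply/funext => t; rewrite big_nil].
rewrite big_cons (_ : (fun t => _) = fun t => X i t + \sum_(j <- r) X j t).
  exact: has_meanD.
by apply/funext => t; rewrite big_cons.
Qed.

(** The second moment is the integral inside the L2 norm, and its being a real number [a] makes that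
    norm finite. *)
Lemma Lfun2_of_second_moment (X : {RV P >-> R}) a :
  ('E_P[fun t => (X t * X t)%R] = a%:E)%E -> (X : Omega -> R) \in Lfun P 2%:E.
Proof.
rewrite unlock => EX2; rewrite inE; apply/andP; split; rewrite inE //=.
rewrite /finite_norm unlock; apply: poweR_lty.
rewrite (_ : (\int[P]_t _)%E = a%:E) ?ltry // -EX2.
by apply: eq_integral => t _; rewrite /= powR_mulrn // real_normK ?num_real.
Qed.

Lemma has_mean_affine_sqr (n : nat) (eps : 'I_n -> {RV P >-> R}) (sigma : R)
    (a : R) (c : 'I_n -> R) :
  (forall i, 'E_P[eps i] = 0)%E ->
  (forall i j, 'E_P[fun t => (eps i t * eps j t)%R]
     = (sigma ^+ 2 *+ (i == j))%R%:E)%E ->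
  has_mean (fun t => (a + \sum_i c i * eps i t) ^+ 2)
    (a ^+ 2 + sigma ^+ 2 * \sum_i c i ^+ 2).
Proof.
move=> mean0 cov.
have L2 i : (eps i : Omega -> R) \in Lfun P 2%:E.
  exact: Lfun2_of_second_moment (cov i i).
have hm1 i : has_mean (eps i) 0.
  split; last exact: mean0.
  by apply: Lfun_subset12 (L2 i); exact: fin_num_measure.
have hm2 i j : has_mean (fun t => eps i t * eps j t) (sigma ^+ 2 *+ (i == j)).
  by split; [exact: Lfun2_mul_Lfun1 | exact: cov].
(* The zero means and zero off-diagonal covariances are kept as explicit summands, so the value
   matches the expanded square term by term and linearity applies. *)
have -> : a ^+ 2 + sigma ^+ 2 * (\sum_i c i ^+ 2) =
    a ^+ 2 + (2 * a * (\sum_i c i * 0)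
      + \sum_i \sum_j (c i * c j) * (sigma ^+ 2 *+ (i == j))).
  rewrite [X in 2 * a * X]big1 => [|i _]; last by rewrite mulr0.
  rewrite mulr0 add0r; congr (_ + _); rewrite mulr_sumr; apply: eq_bigr => i _.
  rewrite (bigD1 i) //= eqxx big1 ?addr0 => [|j /negbTE].
    by rewrite mulr1n; ring.
  by rewrite eq_sym => ->; rewrite mulr0n mulr0.
have -> : (fun t => (a + \sum_i c i * eps i t) ^+ 2) =
    (fun t => a ^+ 2 + (2 * a * (\sum_i c i * eps i t)
      + \sum_i \sum_j (c i * c j) * (eps i t * eps j t))).
  apply/funext => t; have -> : \sum_i \sum_j (c i * c j) * (eps i t * eps j t)
      = (\sum_i c i * eps i t) ^+ 2.
    rewrite expr2 mulr_suml; apply: eq_bigr => i _; rewrite mulr_sumr.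
    by apply: eq_bigr => j _; ring.
  by ring.
apply: has_meanD (has_mean_cst _) (has_meanD (has_meanZ _ _) _).
  by apply: has_mean_sum => i; exact: has_meanZ.
by do 2![apply: has_mean_sum => ?]; exact: has_meanZ.
Qed.

End Moments.

(** * Bias-variance comparison of two families of rates *)

Section BiasVariance.
Context {R : realType} {r : nat}.

(** Squared bias plus variance per coordinate: [z] is the initial error, and noise of variance
    [sigma ^+ 2] enters with weight [1 - rate i ^+ k]. *)
Definition risk (sigma : R) (z rate : 'I_r -> R) (k : nat) : R :=
  \sum_i ((rate i ^+ k * z i) ^+ 2 + sigma ^+ 2 * (1 - rate i ^+ k) ^+ 2).

Lemma ler_exprn m (a b : R) : 0 <= a -> a <= b -> a ^+ m <= b ^+ m.
Proof.
by move=> a_ge0 ab; apply: lerXn2r; rewrite ?nnegrE // (le_trans a_ge0).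
Qed.

Lemma risk_le (sigma snr c : R) (z g h : 'I_r -> R) (hmin hmax : R) (k : nat) :
  0 < hmin -> (forall i, hmin <= h i <= hmax) -> 1 < c ->
  (forall i, Num.sqrt c * hmax <= g i <= c * hmin) ->
  \sum_i z i ^+ 2 = snr * (r%:R * sigma ^+ 2) ->
  2 * hmax ^+ k <= (snr + 1) * (hmin ^+ k) ^+ 2 ->
  risk sigma z h k <= risk sigma z g k.
Proof.
move=> hmin_gt0 h_bd c_gt1 g_bd z_sum k_bd.
have c_gt0 : 0 < c by exact: lt_trans c_gt1.
have sc_ge0 : 0 <= Num.sqrt c by exact: sqrtr_ge0.
set Hm := hmin ^+ k in k_bd *; set HM := hmax ^+ k in k_bd *.
set C := c ^+ k.
have C_ge1 : 1 <= C by apply: exprn_ege1; exact: ltW.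
have Hm_gt0 : 0 < Hm by rewrite exprn_gt0.
(* The coefficients of this lower bound do not depend on [i], so summing it involves [z] only
   through its squared norm. *)
have key i : (C - 1) * Hm ^+ 2 * (z i ^+ 2 + sigma ^+ 2)
      - 2 * sigma ^+ 2 * ((C - 1) * Hm) <=
    (g i ^+ k * z i) ^+ 2 + sigma ^+ 2 * (1 - g i ^+ k) ^+ 2
    - ((h i ^+ k * z i) ^+ 2 + sigma ^+ 2 * (1 - h i ^+ k) ^+ 2).
  have /andP[hl hr] := h_bd i; have /andP[gl gr] := g_bd i.
  have h_ge0 : 0 <= h i by exact: le_trans (ltW hmin_gt0) hl.
  have hmax_ge0 : 0 <= hmax by exact: le_trans h_ge0 hr.
  have g_ge0 : 0 <= g i by apply: le_trans gl; exact: mulr_ge0.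
  have Hl : Hm <= h i ^+ k by apply: ler_exprn => //; exact: ltW.
  have Hr : h i ^+ k <= HM by exact: ler_exprn.
  have Gr : g i ^+ k <= C * Hm by rewrite -exprMn; exact: ler_exprn.
  have Gl : C * HM ^+ 2 <= (g i ^+ k) ^+ 2.
    have -> : C * HM ^+ 2 = ((Num.sqrt c * hmax) ^+ k) ^+ 2.
      by rewrite !exprMn [(_ ^+ k) ^+ 2]exprAC sqr_sqrtr // ltW.
    by do 2![apply: ler_exprn; rewrite ?exprn_ge0 ?mulr_ge0 //].
  move: (h i ^+ k) (g i ^+ k) Hl Hr Gr Gl => H G Hl Hr Gr Gl.
  (* [G ^+ 2 - H ^+ 2] is at least [(C - 1) * HM ^+ 2], and [Hm <= HM]. *)
  have sq1 : (C - 1) * Hm ^+ 2 <= G ^+ 2 - H ^+ 2.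
    have : H ^+ 2 <= HM ^+ 2 by apply: ler_exprn; lra.
    have : Hm ^+ 2 <= HM ^+ 2 by apply: ler_exprn; lra.
    by rewrite -subr_ge0 in C_ge1 => /(ler_wpM2l C_ge1); lra.
  have := ler_wpM2r (addr_ge0 (sqr_ge0 (z i)) (sqr_ge0 sigma)) sq1.
  have : G - H <= (C - 1) * Hm by lra.
  by move/(ler_wpM2l (sqr_ge0 sigma)); lra.
rewrite -subr_ge0 -sumrB; apply: le_trans (ler_sum _ (fun i _ => key i)).
rewrite sumrB -mulr_sumr big_split /= z_sum !sumr_const card_ord.
rewrite -[sigma ^+ 2 *+ r]mulr_natl -[(2 * _ * _) *+ r]mulr_natl.
have -> : (C - 1) * Hm ^+ 2 * (snr * (r%:R * sigma ^+ 2) + r%:R * sigma ^+ 2)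
    - r%:R * (2 * sigma ^+ 2 * ((C - 1) * Hm))
  = (r%:R * sigma ^+ 2) * (C - 1) * ((snr + 1) * Hm ^+ 2 - 2 * Hm) by ring.
(* An index is needed to derive [hmin <= hmax]; without one both sides are 0. *)
have [->|r_gt0] := posnP r; first by rewrite !mul0r.
have /andP[hl hr] := h_bd (Ordinal r_gt0).
have : Hm <= HM.
  by apply: ler_exprn; [exact: ltW | exact: le_trans hl hr].
move=> HmHM; apply: mulr_ge0; last by lra.
by apply: mulr_ge0; [exact: mulr_ge0 (ler0n _ _) (sqr_ge0 _) | rewrite subr_ge0].
Qed.

End BiasVariance.

(** * Coordinates adapted to the singular value decomposition *)

Section SpectralCoordinates.
Context {R : realType}.

Lemma sub_cvE m (u v : 'cV[R]_m) i : (u - v) i 0 = u i 0 - v i 0.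
Proof. by rewrite !mxE. Qed.

Lemma sqnorm2E m (u : 'cV[R]_m) : sqnorm2 u = \sum_i u i 0 ^+ 2.
Proof. by rewrite /sqnorm2 dotE; apply: eq_bigr => i _; rewrite expr2. Qed.

Lemma sqnorm2_isometry m r (V : 'M[R]_(m, r)) u :
  V^T *m V = 1%:M -> sqnorm2 (V *m u) = sqnorm2 u.
Proof.
by move=> VV; rewrite /sqnorm2 /dot trmx_mul mulmxA -(mulmxA _ V^T) VV mulmx1.
Qed.

(** Testing on a basis vector turns a Loewner inequality into scalar ones. *)
Lemma posdef_diag_gt0 m (M : 'M[R]_m) i : posdef M -> 0 < M i i.
Proof.
move=> [_ /(_ (delta_mx i 0))].
have -> : dot (delta_mx i 0) (M *m delta_mx i 0) = M i i.
  by rewrite /dot trmx_delta -rowE -colE !mxE.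
by apply; apply/matrix0Pn; exists i, 0; rewrite mxE !eqxx oner_eq0.
Qed.

Lemma orthogonal_row_mxl m r (V1 : 'M[R]_(m, r)) (V2 : 'M[R]_(m, m - r)) :
  orthogonal_mx (row_mx V1 V2) -> V1^T *m V1 = 1%:M.
Proof.
by case; rewrite tr_row_mx mul_col_row scalar_mx_block => /eq_block_mx[].
Qed.

Section ThinSVD.
Variables (m q r : nat) (A : 'M[R]_(m, q)).
Variables (V1 : 'M[R]_(m, r)) (V2 : 'M[R]_(m, m - r)) (s : 'rV[R]_r).
Variables (U1 : 'M[R]_(q, r)) (U2 : 'M[R]_(q, q - r)).
Hypothesis svdA : is_svd A V1 V2 s U1 U2.

Lemma thin_svd : A = V1 *m diag_mx s *m U1^T.
Proof.
have [_ _ _ _ ->] := svdA.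
by rewrite mul_row_block !mulmx0 !addr0 tr_row_mx mul_row_col mul0mx addr0.
Qed.

(** The coordinates of [A *m u] in the orthonormal columns of [V1]. *)
Definition spectral (u : 'cV[R]_q) : 'cV[R]_r := diag_mx s *m U1^T *m u.

Lemma mulmx_spectral u : A *m u = V1 *m spectral u.
Proof. by rewrite /spectral thin_svd !mulmxA. Qed.

Lemma spectralD u v : spectral (u + v) = spectral u + spectral v.
Proof. exact: mulmxDr. Qed.

Lemma spectralZ a u : spectral (a *: u) = a *: spectral u.
Proof. by rewrite /spectral scalemxAr. Qed.

Lemma sqnorm2_mulmx u : sqnorm2 (A *m u) = sqnorm2 (spectral u).
Proof.
have [orthV _ _ _ _] := svdA.
by rewrite mulmx_spectral sqnorm2_isometry //; exact: orthogonal_row_mxl orthV.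
Qed.

(** The least-squares gradient becomes diagonal: by orthonormality of the columns of [U1] and [V1],
    applying [A^T] and then [spectral] is [V1^T] followed by the squared singular values. *)
Lemma spectral_normal_eq u e j :
  spectral (A^T *m (A *m u - e)) j 0 =
    s 0 j ^+ 2 * (spectral u j 0 - (V1^T *m e) j 0).
Proof.
have [/orthogonal_row_mxl VV /orthogonal_row_mxl UU _ _ _] := svdA.
have -> : spectral (A^T *m (A *m u - e)) =
    diag_mx s *m (diag_mx s *m (spectral u - V1^T *m e)).
  rewrite mulmx_spectral {1}/spectral {1}thin_svd !trmx_mul trmxK tr_diag_mx.
  rewrite -!mulmxA (mulmxA U1^T) UU mul1mx mulmxBr !mulmxA.
  by rewrite VV mul1mx.
by rewrite !mul_diag_mx !mxE mulrA -expr2.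
Qed.

End ThinSVD.
End SpectralCoordinates.

(** * Linear dynamics on a fixed activation pattern *)

Section Linearization.
Context {R : realType} {n d L : nat}.
Variables (x : 'I_n -> 'cV[R]_d) (w0 : 'cV[R]_(L * d)).
Implicit Types w : 'cV[R]_(L * d).

Let A : 'M[R]_(n, L * d) := act_mx w0 x.
Definition same_pattern w := forall i, act w (x i) = act w0 (x i).

Lemma relu_net_same w i : same_pattern w -> relu_net w (x i) = (A *m w) i 0.
Proof.
move=> wP; rewrite relu_net_act wP dotE mxE.
by apply: eq_bigr => j _; rewrite [A _ _]mxE.
Qed.

Lemma grad_loss_same y w :
  same_pattern w -> grad_loss x y w = A^T *m (A *m w - \col_i y i).
Proof.
move=> wP; rewrite grad_lossE; apply/matrixP => j o.
rewrite summxE ord1 mxE; apply: eq_bigr => i _.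
by rewrite relu_net_same // wP !mxE mulrC.
Qed.

Variables (wbar : 'cV[R]_(L * d)) (ystar : 'I_n -> R).
Hypothesis A2 : forall i : 'I_n, act wbar (x i) = act w0 (x i)
     /\ ystar i = dot (act wbar (x i)) wbar.
Variables (r : nat) (V1 : 'M[R]_(n, r)) (V2 : 'M[R]_(n, n - r)).
Variables (s : 'rV[R]_r).
Variables (U1 : 'M[R]_(L * d, r)) (U2 : 'M[R]_(L * d, L * d - r)).
Hypothesis svdA : is_svd A V1 V2 s U1 U2.

Lemma ystarE i : ystar i = (A *m wbar) i 0.
Proof.
have [_ ->] := A2 i.
rewrite -relu_net_act relu_net_same // => l; by case: (A2 l).
Qed.

(** Since [ystar] is [A *m wbar], this is the prediction error of [w] in the basis [V1], as long as
    [w] keeps the pattern of [w0]. *)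
Definition coord w : 'cV[R]_r := spectral s U1 (w - wbar).

Lemma error_coord w : same_pattern w ->
  \sum_i (ystar i - relu_net w (x i)) ^+ 2 = \sum_j coord w j 0 ^+ 2.
Proof.
move=> wP; rewrite -sqnorm2E -(sqnorm2_mulmx svdA) sqnorm2E mulmxBr.
apply: eq_bigr => i _.
by rewrite relu_net_same // ystarE sub_cvE -sqrrN opprB.
Qed.

Section Noisy.
Variables (e y : 'I_n -> R).
Hypothesis yE : forall i, y i = ystar i + e i.
Let noise : 'cV[R]_r := V1^T *m \col_i e i.

(** Base point and gradient point are separate, so that one formula covers the descent steps
    ([c = - eta]) and the ascent step ([c = rho]). *)
Lemma coord_step c w w' j : same_pattern w' ->
  coord (w + c *: grad_loss x y w') j 0 =
    coord w j 0 + c * s 0 j ^+ 2 * (coord w' j 0 - noise j 0).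
Proof.
move=> w'P; rewrite grad_loss_same // /coord (addrAC w) (spectralD _ _ (w - wbar)) spectralZ.
have -> : A *m w' - \col_i y i = A *m (w' - wbar) - \col_i e i.
  rewrite mulmxBr.
  by apply/matrixP => i o; rewrite ord1 !sub_cvE -addrA -opprD !mxE yE ystarE !mxE.
by rewrite mxE [X in _ + X]mxE (spectral_normal_eq svdA) mulrA.
Qed.

Variables (eta rho : R).

(** One step multiplies the distance from the coordinate to its fixed point [noise j 0] by [g]. *)
Lemma coord_gd k j :
  (forall k', (k' <= k)%N -> same_pattern (gd x y eta w0 k')) ->
  let g := 1 - eta * s 0 j ^+ 2 in
  coord (gd x y eta w0 k) j 0 = g ^+ k * coord w0 j 0 + (1 - g ^+ k) * noise j 0.
Proof.
move=> + g; elim: k => [|k IHk] pat; first by rewrite expr0; ring.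
have -> : gd x y eta w0 k.+1 =
    gd x y eta w0 k + - eta *: grad_loss x y (gd x y eta w0 k).
  by rewrite scaleNr.
rewrite coord_step ?IHk; first by rewrite (exprS g); move: (g ^+ k) => gk; rewrite /g; ring.
- by move=> k' k'k; apply: pat; exact: leqW.
- by apply: pat.
Qed.

(** The ascent step multiplies the distance to [noise] by [1 + rho * s 0 j ^+ 2]; the descent step
    taken with that gradient then has total factor [h]. *)
Lemma coord_sam k j :
  (forall k', (k' < k)%N -> same_pattern (sam x y eta rho w0 k')) ->
  (forall k', (k' < k)%N ->
     same_pattern (sam_ascent x y rho (sam x y eta rho w0 k'))) ->
  let h := 1 - eta * s 0 j ^+ 2 - eta * rho * (s 0 j ^+ 2) ^+ 2 in
  coord (sam x y eta rho w0 k) j 0 =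
    h ^+ k * coord w0 j 0 + (1 - h ^+ k) * noise j 0.
Proof.
move=> + + h; elim: k => [|k IHk] pat pat'; first by rewrite expr0; ring.
have -> : sam x y eta rho w0 k.+1 = sam x y eta rho w0 k +
    - eta *: grad_loss x y (sam_ascent x y rho (sam x y eta rho w0 k)).
  by rewrite scaleNr.
rewrite coord_step; last exact: pat'.
rewrite /sam_ascent coord_step; last exact: pat.
rewrite IHk; first by rewrite (exprS h); move: (h ^+ k) => hk; rewrite /h; ring.
- by move=> k' k'k; apply: pat; exact: ltnW.
- by move=> k' k'k; apply: pat'; exact: ltnW.
Qed.

End Noisy.

(** * Closed form of the expected error *)

Section Expectation.
Context {disp : measure_display} {Omega : measurableType disp}.
Variables (P : probability Omega R) (sigma : R) (eps : 'I_n -> {RV P >-> R}).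
Hypothesis eps_mean : forall i, ('E_P[eps i] = 0)%E.
Hypothesis eps_cov : forall i j,
  ('E_P[fun omega => (eps i omega * eps j omega)%R]
     = (sigma ^+ 2 *+ (i == j))%R%:E)%E.

(** The error agrees almost surely with [F], a polynomial in the noise of known mean. As [W] carries
    no measurability, the integrals are equated by two almost-everywhere inequalities. *)
Lemma pred_error_risk (W : Omega -> 'cV[R]_(L * d)) (rate : 'I_r -> R) k :
  {ae P, forall omega, same_pattern (W omega) /\ forall j,
     coord (W omega) j 0 = rate j ^+ k * coord w0 j 0
       + (1 - rate j ^+ k) * (V1^T *m \col_i eps i omega) j 0} ->
  pred_error P x ystar W =
    (n%:R^-1 * risk sigma (fun j => coord w0 j 0) rate k)%:E.
Proof.
move=> WP.
pose c j i := (1 - rate j ^+ k) * V1 i j.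
pose F omega := n%:R^-1 *
  \sum_j (rate j ^+ k * coord w0 j 0 + \sum_i c j i * eps i omega) ^+ 2.
have [_ EF] : has_mean P F
    (n%:R^-1 * risk sigma (fun j => coord w0 j 0) rate k).
  apply: has_meanZ; apply: has_mean_sum => j.
  (* Column [j] of [V1] has unit norm, so projecting the noise on it preserves the variance. *)
  have -> : (1 - rate j ^+ k) ^+ 2 = \sum_i c j i ^+ 2.
    under [RHS]eq_bigr do rewrite exprMn.
    rewrite -mulr_sumr (_ : \sum_i _ = 1) ?mulr1 //.
    have [/orthogonal_row_mxl VV _ _ _ _] := svdA.
    have : (V1^T *m V1) j j = 1 by rewrite VV mxE eqxx.
    by rewrite mxE => <-; apply: eq_bigr => i _; rewrite mxE expr2.
  exact: has_mean_affine_sqr.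
have n_ge0 : 0 <= n%:R^-1 :> R by rewrite invr_ge0 ler0n.
have WF : {ae P, forall omega,
    n%:R^-1 * \sum_(i < n) (ystar i - relu_net (W omega) (x i)) ^+ 2 = F omega}.
  apply: filterS WP => omega [pat coordW]; rewrite error_coord // /F.
  congr (_ * _); apply: eq_bigr => j _; rewrite coordW; congr ((_ + _) ^+ 2).
  rewrite mxE mulr_sumr; apply: eq_bigr => i _.
  by rewrite !mxE /c mulrA.
rewrite /pred_error -EF unlock; apply/eqP; rewrite eq_le.
apply/andP; split; apply: ge0_le_integral_ae => [omega|omega|]; rewrite ?lee_fin;
  try by apply: mulr_ge0 => //; apply: sumr_ge0 => ? _; exact: sqr_ge0.
- by apply: filterS WF => omega ->.
- by apply: filterS WF => omega ->.
Qed.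

End Expectation.
End Linearization.

(** * From the bound on the iteration count to the comparison of errors *)

Lemma rate_exponent_bound {R : realType} (snr hmin hmax : R) (k : nat) :
  0 < hmin -> hmin <= hmax -> hmax < 1 -> 0 < snr + 1 ->
  k%:R <= ln (2 / (snr + 1)) / ln (hmin ^+ 2 / hmax) ->
  2 * hmax ^+ k <= (snr + 1) * (hmin ^+ k) ^+ 2.
Proof.
move=> hmin_gt0 hmin_le hmax_lt1 snr_gt0.
have hmax_gt0 : 0 < hmax by exact: lt_le_trans hmin_le.
set q := hmin ^+ 2 / hmax.
have q_gt0 : 0 < q by rewrite divr_gt0 // exprn_gt0.
have q_lt1 : q < 1 by rewrite /q ltr_pdivrMr // mul1r; nra.
have lnq_lt0 : ln q < 0 by apply: ln_lt0; rewrite q_gt0.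
(* As [ln q] is negative, multiplying by it reverses the inequality and yields
   [2 / (snr + 1) <= q ^+ k]. *)
rewrite ler_ndivlMr // [k%:R * _]mulr_natl -lnXn // ler_ln ?posrE ?divr_gt0 ?exprn_gt0 //.
rewrite ler_pdivrMr // /q expr_div_n -exprM mulnC exprM.
by rewrite mulrAC ler_pdivlMr ?exprn_gt0 // mulrC [leRHS]mulrC.
Qed.

Theorem proposition1
  (R : realType)
  (disp : measure_display) (Omega : measurableType disp)
  (P : probability Omega R)
  (n d L : nat)
  (* data and noise *)
  (x : 'I_n -> 'cV[R]_d) (ystar : 'I_n -> R)
  (sigma : R) (sigma_gt0 : 0 < sigma)
  (eps : 'I_n -> {RV P >-> R})
  (eps_indep : mutually_independent eps)
  (eps_mean : forall i, ('E_P[eps i] = 0)%E)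
  (eps_cov : forall i j,
     ('E_P[fun omega => (eps i omega * eps j omega)%R]
     = (sigma ^+ 2 *+ (i == j))%R%:E)%E)
  (* algorithms *)
  (eta rho : R) (eta_gt0 : 0 < eta) (rho_ge0 : 0 <= rho)
  (w0 : 'cV[R]_(L * d))
  (* (A1) *)
  (kbar : nat) (kbar_ge1 : (1 <= kbar)%N)
  (A1 : {ae P, forall omega, forall k, (k <= kbar)%N -> forall i : 'I_n,
     act (sam x (observed ystar eps omega) eta rho w0 k) (x i) = act w0 (x i)
     /\ act (gd x (observed ystar eps omega) eta w0 k) (x i) = act w0 (x i)})
  (* (A1) at the intermediate points where SAM evaluates its gradient *)
  (A1_ascent : {ae P, forall omega, forall k, (k < kbar)%N -> forall i : 'I_n,
     act (sam_ascent x (observed ystar eps omega) rho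
            (sam x (observed ystar eps omega) eta rho w0 k)) (x i)
     = act w0 (x i)})
  (* (A2) *)
  (wbar : 'cV[R]_(L * d))
  (A2 : forall i : 'I_n, act wbar (x i) = act w0 (x i)
     /\ ystar i = dot (act wbar (x i)) wbar)
  (* singular value decomposition of A *)
  (r : nat) (r_gt0 : (0 < r)%N) (rankA : \rank (act_mx w0 x) = r)
  (V1 : 'M[R]_(n, r)) (V2 : 'M[R]_(n, n - r))
  (s : 'rV[R]_r)
  (U1 : 'M[R]_(L * d, r)) (U2 : 'M[R]_(L * d, L * d - r))
  (svdA : is_svd (act_mx w0 x) V1 V2 s U1 U2)
  (w0_range : w0 = U1 *m U1^T *m w0) :
  let A := act_mx w0 x in
  let D1 := diag_mx s *m diag_mx s in
  let d1 := s 0 (Ordinal r_gt0) ^+ 2 in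
  let dr := s 0 (rev_ord (Ordinal r_gt0)) ^+ 2 in
  let SNR := sqnorm2 (A *m (wbar - w0)) / (r%:R * sigma ^+ 2) in
  let M := 1%:M - eta *: D1 - (eta * rho) *: (D1 *m D1) in
  loewner_lt 0 M ->
  loewner_lt M 1%:M ->
  (exists c0 : R,
     [/\ 1 < c0,
         1 - eta * dr <= c0 * (1 - eta * d1 - eta * rho * d1 ^+ 2) &
         1 - eta * d1 >=
           Num.sqrt c0 * (1 - eta * dr - eta * rho * dr ^+ 2)]) ->
  1 <= SNR ->
  forall k : nat,
    k%:R <= Num.min
      (ln (2 / (SNR + 1)) /
       ln ((1 - eta * d1 - eta * rho * d1 ^+ 2) ^+ 2 /
           (1 - eta * dr - eta * rho * dr ^+ 2)))
      kbar%:R ->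
    (pred_error P x ystar
       (fun omega => sam x (observed ystar eps omega) eta rho w0 k)
     <= pred_error P x ystar
          (fun omega => gd x (observed ystar eps omega) eta w0 k))%E.

Proof.
move=> A D1 d1 dr SNR M M_gt0 M_lt1 [c0 [c0_gt1 c0_up c0_lo]] SNR_ge1 k.
rewrite le_min ler_nat => /andP[k_le k_kbar].
pose g (j : 'I_r) := 1 - eta * s 0 j ^+ 2.
pose h (j : 'I_r) := 1 - eta * s 0 j ^+ 2 - eta * rho * (s 0 j ^+ 2) ^+ 2.
have [_ _ s_gt0 s_le _] := svdA.
(* [M] is diagonal with entries [h j]. *)
have h_gt0 j : 0 < h j.
  have -> : h j = (M - 0) j j.
    rewrite /M /D1 subr0 mulmx_diag mulmx_diag !mxE eqxx !mulr1n /h -!expr2.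
    by ring.
  exact: posdef_diag_gt0.
(* Both rates are nonincreasing in the singular value, so they are least at index 0 and greatest at
   index [r - 1]. *)
have gap_ge0 (a b : R) : 0 < a -> a <= b ->
    [/\ 1 - eta * b ^+ 2 <= 1 - eta * a ^+ 2 &
    1 - eta * b ^+ 2 - eta * rho * (b ^+ 2) ^+ 2
    <= 1 - eta * a ^+ 2 - eta * rho * (a ^+ 2) ^+ 2].
  move=> a_gt0 ab; have a_ge0 := ltW a_gt0.
  have ab2 : a ^+ 2 <= b ^+ 2 by exact: ler_exprn.
  have ab4 : (a ^+ 2) ^+ 2 <= (b ^+ 2) ^+ 2 by apply: ler_exprn => //; exact: sqr_ge0.
  have := ler_wpM2l (ltW eta_gt0) ab2.
  have := ler_wpM2l (mulr_ge0 (ltW eta_gt0) rho_ge0) ab4.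
  by split; lra.
set i1 := Ordinal r_gt0 in d1 c0_up c0_lo k_le.
set ir := rev_ord i1 in dr c0_up c0_lo k_le.
have i1_le j : [/\ g i1 <= g j & h i1 <= h j].
  by apply: gap_ge0 => //; apply: s_le.
have ir_ge j : [/\ g j <= g ir & h j <= h ir].
  by apply: gap_ge0 => //; apply: s_le; rewrite /= subn1 -ltnS prednK.
have h_lt1 : h ir < 1.
  have : 0 < eta * s 0 ir ^+ 2 by rewrite mulr_gt0 // exprn_gt0.
  have : 0 <= eta * rho * (s 0 ir ^+ 2) ^+ 2.
    by rewrite mulr_ge0 ?sqr_ge0 // mulr_ge0 // ltW.
  by rewrite /h; lra.
have k_bd : 2 * h ir ^+ k <= (SNR + 1) * (h i1 ^+ k) ^+ 2.
  apply: rate_exponent_bound => //; first by case: (i1_le ir).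
  by apply: ltr_wpDl => //; exact: le_trans SNR_ge1.
(* All pattern conditions are gathered on one almost sure event; ascent points occur only for
   [k' < kbar], since step [k'] produces iterate [k' + 1]. *)
have patterns : {ae P, forall omega, forall k', (k' <= kbar)%N ->
    [/\ same_pattern x w0 (sam x (observed ystar eps omega) eta rho w0 k'),
        same_pattern x w0 (gd x (observed ystar eps omega) eta w0 k') &
        (k' < kbar)%N -> same_pattern x w0
          (sam_ascent x (observed ystar eps omega) rho
            (sam x (observed ystar eps omega) eta rho w0 k'))]}.
  apply: filterS2 A1 A1_ascent => omega pat asc k' k'_le.
  split=> [i|i|k'_lt i]; last exact: asc.
    by case: (pat k' k'_le i).
  by case: (pat k' k'_le i).
pose z j := coord wbar s U1 w0 j 0.
have sam_risk : pred_error P x ystar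
    (fun omega => sam x (observed ystar eps omega) eta rho w0 k) =
    (n%:R^-1 * risk sigma z h k)%:E.
  apply: (pred_error_risk A2 svdA eps_mean eps_cov).
  apply: filterS patterns => omega pat; split; first by case: (pat k k_kbar).
  move=> j; apply: (coord_sam A2 svdA) => // k' k'k.
    by case: (pat k' (leq_trans (ltnW k'k) k_kbar)).
  have k'_lt := leq_trans k'k k_kbar.
  by case: (pat k' (ltnW k'_lt)) => _ _; apply.
have gd_risk : pred_error P x ystar
    (fun omega => gd x (observed ystar eps omega) eta w0 k) =
    (n%:R^-1 * risk sigma z g k)%:E.
  apply: (pred_error_risk A2 svdA eps_mean eps_cov).
  apply: filterS patterns => omega pat; split; first by case: (pat k k_kbar).
  move=> j; apply: (coord_gd A2 svdA) => // k' k'k.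
  by case: (pat k' (leq_trans k'k k_kbar)).
rewrite sam_risk gd_risk lee_fin ler_wpM2l ?invr_ge0 //.
apply: (risk_le (snr := SNR) (c := c0) (hmin := h i1) (hmax := h ir)) => // [i|i|].
- by case: (i1_le i) => _ ->; case: (ir_ge i).
- case: (i1_le i) => [g_ge _]; case: (ir_ge i) => [g_le _].
  by rewrite (le_trans c0_lo g_ge) (le_trans g_le c0_up).
(* The SNR is defined with [wbar - w0] and [coord] with [w0 - wbar]; squaring absorbs the sign. *)
- rewrite /SNR divfK; last first.
    by rewrite mulf_neq0 ?pnatr_eq0 -?lt0n // expf_neq0 // gt_eqF.
  rewrite (sqnorm2_mulmx svdA) sqnorm2E -opprB -scaleN1r spectralZ.
  by apply: eq_bigr => j _; rewrite [in RHS]mxE mulN1r sqrrN.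
Qed.
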